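(* Let $t>1$, $\tau>2$, $\beta=\tau-1$ and $s=t\beta$. Let $x$ be irrational with continued fraction convergents $p_k/q_k$, and for $k\ge1$ put $\rho_k(x)=q_k^{\,\tau}\,|x-p_k/q_k|$. Then for every $k\ge1$, $$\bigl(2\rho_k(x)\bigr)^{-t}\;<\;\frac{q_{k+1}^{\,t}}{q_k^{\,s}}\;<\;\rho_k(x)^{-t},$$ and consequently $\sum_{k\ge0}q_{k+1}^{\,t}/q_k^{\,s}<\infty$ if and only if $\sum_{k\ge1}\rho_k(x)^{-t}<\infty$.
   Context: Convergents of $x=[a_0;a_1,a_2,\dots]$ are indexed so that $q_{-1}=0$, $q_0=1$, $q_{k+1}=a_{k+1}q_k+q_{k-1}$ (and $p_0=a_0$). *)

(* Defs.v *)
From mathcomp Require Import all_boot all_order all_algebra.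
From mathcomp Require Import all_classical all_reals all_analysis.

Set Implicit Arguments.
Unset Strict Implicit.
Unset Printing Implicit Defensive.

Import Order.TTheory GRing.Theory Num.Theory.

Local Open Scope ring_scope.

(* Complete quotients x_0 = x, x_{k+1} = 1 / (x_k - floor x_k). The totalized
   inverse 0^-1 = 0 is only reached when x is rational. *)
Definition cf_quotient (R : realType) (x : R) (k : nat) : R :=
  iter k (fun y : R => (y - (Num.floor y)%:~R)^-1) x.

Definition cf_coef (R : realType) (x : R) (k : nat) : int :=
  Num.floor (cf_quotient x k).

(* The sequence u with u_{-1} = um1, u_0 = u0 and
   u_{k+1} = a_{k+1} u_k + u_{k-1} for k >= 0. *)
Fixpoint cf_rec (a : nat -> int) (um1 u0 : int) (n : nat) : int :=
  if n is k.+1 then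
    a k.+1 * cf_rec a um1 u0 k + (if k is j.+1 then cf_rec a um1 u0 j else um1)
  else u0.

Definition cf_num (R : realType) (x : R) (k : nat) : R :=
  (cf_rec (cf_coef x) 1 (cf_coef x 0) k)%:~R.

Definition cf_den (R : realType) (x : R) (k : nat) : R :=
  (cf_rec (cf_coef x) 0 1 k)%:~R.

Definition cf_rho (R : realType) (tau x : R) (k : nat) : R :=
  cf_den x k `^ tau * `|x - cf_num x k / cf_den x k|.

(* Main.v *)
Require Import Defs.
From mathcomp Require Import all_boot all_order all_algebra.
From mathcomp Require Import all_classical all_reals all_analysis.
From mathcomp Require Import ring lra.

(* With y the (k+1)-st complete quotient and D = q_k y + q_{k-1}, the identity
   x = (p_k y + p_{k-1}) / D and the determinant p_k q_{k-1} - q_k p_{k-1} = +-1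
   give |x - p_k/q_k| = 1 / (q_k D), so that rho_k = q_k^beta / D.  Since
   a_{k+1} < y < a_{k+1} + 1, one has q_{k+1} < D < q_{k+1} + q_k <= 2 q_{k+1},
   and raising to the power t gives both bounds.  They hold for k = 0 too, so
   the two series differ by a bounded factor and one finite term. *)

Set Implicit Arguments.
Unset Strict Implicit.
Unset Printing Implicit Defensive.

Import Order.TTheory GRing.Theory Num.Theory.

Local Open Scope ring_scope.

Local Arguments cf_quotient : simpl never.

(* The term of index n - 1, so that [cf_pred a um1 u0 0] is u_{-1}. *)
Definition cf_pred (a : nat -> int) (um1 u0 : int) (n : nat) : int :=
  if n is j.+1 then cf_rec a um1 u0 j else um1.

Lemma cf_recS a um1 u0 k :
  cf_rec a um1 u0 k.+1 = a k.+1 * cf_rec a um1 u0 k + cf_pred a um1 u0 k.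
Proof. by case: k. Qed.

(** One step of the recurrence multiplies the matrix of consecutive terms of both sequences by a
    matrix of determinant -1. *)
Lemma cf_rec_det (a : nat -> int) (um1 u0 vm1 v0 : int) k :
  cf_rec a um1 u0 k * cf_pred a vm1 v0 k - cf_rec a vm1 v0 k * cf_pred a um1 u0 k
  = (-1) ^+ k * (u0 * vm1 - v0 * um1).
Proof.
elim: k => [|k IH]; first by rewrite expr0 mul1r.
by rewrite !cf_recS /= exprS -mulrA -IH; ring.
Qed.

Lemma cf_rec_gt0 (a : nat -> int) (um1 u0 : int) :
  (forall k, 0 < a k.+1) -> 0 <= um1 -> 0 < u0 ->
  forall k, 0 < cf_rec a um1 u0 k /\ 0 <= cf_pred a um1 u0 k.
Proof.
move=> a_gt0 um1_ge0 u0_gt0; elim=> [//|k [rec_gt0 pred_ge0]].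
by rewrite cf_recS /= ltr_pwDl ?mulr_gt0 // ltW.
Qed.

Lemma powR_inv (R : realType) (a r : R) : 0 <= a -> a^-1 `^ r = (a `^ r)^-1.
Proof. by move=> a_ge0; rewrite -powR_inv1 // -powRrM mulN1r powRN. Qed.

Section Irrational.
Variables (R : realType) (x : R).
Hypothesis hx : irrational x.

Lemma cf_quotientS k :
  cf_quotient x k.+1 = (cf_quotient x k - (cf_coef x k)%:~R)^-1.
Proof. by []. Qed.

(** A rational x_{k+1} would make x_k = a_k + 1/x_{k+1} rational. Hence each floor lies strictly
    below its quotient and the default [0^-1] never occurs. *)
Lemma cf_quotient_irrational k : irrational (cf_quotient x k).
Proof.
elim: k => [//|k IH]; rewrite cf_quotientS => -[q _ qE]; apply: IH.
exists (q^-1 + (cf_coef x k)%:~R) => //.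
by rewrite rmorphD /= fmorphV /= ratr_int qE invrK subrK.
Qed.

Lemma cf_coef_lt k : (cf_coef x k)%:~R < cf_quotient x k.
Proof.
rewrite lt_neqAle floor_le andbT; apply/eqP => aE.
by apply: (@cf_quotient_irrational k); exists (cf_coef x k)%:~R; rewrite ?ratr_int.
Qed.

Lemma cf_quotient_lt k : cf_quotient x k < (cf_coef x k)%:~R + 1.
Proof. by rewrite -[X in _ < _ + X]/(1%:~R) -intrD floorD1_gt. Qed.

Lemma cf_quotientS_gt1 k : 1 < cf_quotient x k.+1.
Proof.
have := cf_coef_lt k; have := cf_quotient_lt k => lt1 gt0.
by rewrite cf_quotientS invf_gt1; lra.
Qed.

Lemma cf_coefS_gt0 k : 0 < cf_coef x k.+1.
Proof. by rewrite gtz0_ge1 floor_ge_int ltW // cf_quotientS_gt1. Qed.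

Lemma cf_quotientE k :
  cf_quotient x k = (cf_coef x k)%:~R + (cf_quotient x k.+1)^-1.
Proof. by rewrite cf_quotientS invrK addrC subrK. Qed.

(** Initial values [0 1] give D, and [1 (cf_coef x 0)] gives p_k y + p_{k-1}. *)
Let value (um1 u0 : int) k : R :=
  (cf_rec (cf_coef x) um1 u0 k)%:~R * cf_quotient x k.+1
  + (cf_pred (cf_coef x) um1 u0 k)%:~R.

(** Substitute y_{k+1} = a_{k+1} + 1/y_{k+2}. The factor does not depend on the initial values, so
    the quotient of two such sequences is constant in k. *)
Let valueS um1 u0 k :
  value um1 u0 k.+1 = value um1 u0 k * cf_quotient x k.+2.
Proof.
rewrite /value cf_recS /= (cf_quotientE k.+1) rmorphD rmorphM /=.
have : cf_quotient x k.+2 != 0 by have := cf_quotientS_gt1 k.+1; lra.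
by move=> y_neq0; field.
Qed.

Let mul_value k : x * value 0 1 k = value 1 (cf_coef x 0) k.
Proof.
elim: k => [|k IH]; last by rewrite !valueS mulrA IH.
rewrite /value /= {1}[x](cf_quotientE 0).
have : cf_quotient x 1 != 0 by have := cf_quotientS_gt1 0; lra.
by move=> y_neq0; field.
Qed.

Lemma cf_den_ge1 k : 1 <= cf_den x k.
Proof.
have [+ _] := cf_rec_gt0 cf_coefS_gt0 (lexx 0) ltr01 k.
by rewrite gtz0_ge1 -(ler_int R).
Qed.

(* Here D is q_k y_{k+1} + q_{k-1}, with y_{k+1} the complete quotient. *)
Lemma cf_error k : exists D : R,
  [/\ cf_den x k.+1 < D, D < 2 * cf_den x k.+1 &
      `|x - cf_num x k / cf_den x k| = (cf_den x k * D)^-1].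
Proof.
exists (value 0 1 k).
have den_ge1 := cf_den_ge1 k.
have [_ pred_ge0] := cf_rec_gt0 cf_coefS_gt0 (lexx 0) ltr01 k.
have pred_ge0R : 0 <= (cf_pred (cf_coef x) 0 1 k)%:~R :> R by rewrite ler0z.
have denS : cf_den x k.+1 = (cf_coef x k.+1)%:~R * cf_den x k
    + (cf_pred (cf_coef x) 0 1 k)%:~R.
  by rewrite /cf_den cf_recS rmorphD rmorphM.
have coef_lt := cf_coef_lt k.+1; have lt_coef := cf_quotient_lt k.+1.
have coef_ge1 : 1 <= (cf_coef x k.+1)%:~R :> R.
  by rewrite -[1]/(1%:~R) ler_int -gtz0_ge1 cf_coefS_gt0.
(* D - q_{k+1} = (y - a_{k+1}) q_k. *)
have den_lt : cf_den x k.+1 < value 0 1 k.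
  by rewrite denS /value -/(cf_den x k); nra.
(* 2 q_{k+1} - D = (a_{k+1} + 1 - y) q_k + (a_{k+1} - 1) q_k + q_{k-1}, where only the first term
   need be positive. *)
split=> //; first by rewrite denS /value -/(cf_den x k); nra.
have D_gt0 : 0 < value 0 1 k.
  by apply: lt_trans den_lt; rewrite (lt_le_trans ltr01) // cf_den_ge1.
have den_gt0 : 0 < cf_den x k by exact: lt_le_trans den_ge1.
have -> : x - cf_num x k / cf_den x k
    = (-1) ^+ k / (cf_den x k * value 0 1 k).
  have xE : x = value 1 (cf_coef x 0) k / value 0 1 k.
    by rewrite -mul_value mulfK // gt_eqF.
  (* Denominators come first here: x - p_k/q_k has numerator q_k p_{k-1} - p_k q_{k-1}, which is
     (-1)^k. *)
  have := congr1 (fun z : int => z%:~R : R)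
    (cf_rec_det (cf_coef x) 0 1 1 (cf_coef x 0) k).
  rewrite mulr0 subr0 !mulr1 rmorphB !rmorphM rmorphXn /= rmorphN1.
  rewrite -/(cf_den x k) -/(cf_num x k) => <-.
  rewrite {1}xE; move: D_gt0; rewrite /value -/(cf_den x k) -/(cf_num x k).
  by move=> D_gt0; field; rewrite !gt_eqF.
by rewrite normrM normrX normrN1 expr1n mul1r gtr0_norm ?invr_gt0 ?mulr_gt0.
Qed.

Lemma cf_rho_bounds (t tau : R) k : 0 < t -> 0 < tau ->
  (2 * cf_rho tau x k) `^ (- t)
    < cf_den x k.+1 `^ t / cf_den x k `^ (t * (tau - 1)) /\
  cf_den x k.+1 `^ t / cf_den x k `^ (t * (tau - 1)) < cf_rho tau x k `^ (- t).
Proof.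
move=> t_gt0 tau_gt0; have [D [den_lt lt_den errE]] := cf_error k.
have q_gt0 : 0 < cf_den x k by exact: lt_le_trans (cf_den_ge1 k).
have r_gt0 : 0 < cf_den x k.+1 by exact: lt_le_trans (cf_den_ge1 _).
have D_gt0 : 0 < D by exact: lt_trans den_lt.
(* Taking c = 2 and c = 1 reduces the two bounds to D/2 < q_{k+1} < D. *)
have rhoE c : 0 < c ->
    (c * cf_rho tau x k) `^ (- t) = (D / c) `^ t / cf_den x k `^ (t * (tau - 1)).
  move=> c_gt0; rewrite /cf_rho errE -(mulr_powRB1 (ltW q_gt0) tau_gt0).
  have p_gt0 : 0 < cf_den x k `^ (tau - 1) by exact: powR_gt0.
  have invE : (c * (cf_den x k * cf_den x k `^ (tau - 1) * (cf_den x k * D)^-1))^-1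
      = D / c * (cf_den x k `^ (tau - 1))^-1.
    by field; rewrite !gt_eqF.
  rewrite powRN -powR_inv ?invE; last first.
    by rewrite !mulr_ge0 ?invr_ge0 ?mulr_ge0 // ltW.
  by rewrite powRM ?powR_inv ?invr_ge0 ?divr_ge0 1?ltW // -powRrM [t * _]mulrC.
have w_gt0 : 0 < (cf_den x k `^ (t * (tau - 1)))^-1.
  by rewrite invr_gt0 powR_gt0.
split.
  rewrite rhoE // ltr_pM2r //; apply: gt0_ltr_powR => //.
  - by rewrite nnegrE divr_ge0 ?ltW.
  - by rewrite nnegrE ltW.
  - by rewrite ltr_pdivrMr // mulrC.
rewrite -[cf_rho _ _ _]mul1r rhoE // ltr_pM2r // divr1.
by apply: gt0_ltr_powR; rewrite ?nnegrE ?(ltW r_gt0) ?(ltW D_gt0).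
Qed.

End Irrational.

Theorem lemma6p1 (R : realType) (t tau beta s x : R)
    (ht : 1 < t) (htau : 2 < tau) (hbeta : beta = tau - 1) (hs : s = t * beta)
    (hx : irrational x) :
  (forall k : nat, (1 <= k)%N ->
     (2 * cf_rho tau x k) `^ (- t) < cf_den x k.+1 `^ t / cf_den x k `^ s /\
     cf_den x k.+1 `^ t / cf_den x k `^ s < cf_rho tau x k `^ (- t)) /\
  ((\sum_(0 <= k <oo) (cf_den x k.+1 `^ t / cf_den x k `^ s)%:E < +oo)%E <->
   (\sum_(1 <= k <oo) (cf_rho tau x k `^ (- t))%:E < +oo)%E).
Proof.
have t_gt0 : 0 < t by lra.
have tau_gt0 : 0 < tau by lra.
have bounds := fun k => cf_rho_bounds hx k t_gt0 tau_gt0.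
rewrite hs hbeta; split=> [k _|]; first exact: bounds.
have term_ge0 k :
    (0 <= (cf_den x k.+1 `^ t / cf_den x k `^ (t * (tau - 1)))%:E)%E.
  by rewrite lee_fin divr_ge0 ?powR_ge0.
have rho_ge0 k : 0 <= cf_rho tau x k by rewrite mulr_ge0 ?powR_ge0.
(* The term k = 0 is split off, so that both series start at 1. *)
rewrite nneseries_recl //; split=> [|rho_fin].
  move=> /(le_lt_trans (leeDr _ (term_ge0 0%N))) term_fin.
  (* The factor [2 ^ t] comes from (2 rho_k)^(-t) = 2^(-t) rho_k^(-t) in the lower bound. *)
  apply: (@le_lt_trans _ _ (\sum_(1 <= k <oo) ((2 `^ t)%:E *
      (cf_den x k.+1 `^ t / cf_den x k `^ (t * (tau - 1)))%:E))%E).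
    apply: lee_nneseries => [k _ _|k _]; first by rewrite lee_fin powR_ge0.
    rewrite -EFinM lee_fin -ler_pdivrMl ?powR_gt0 // -(powRN 2) -powRM //.
    by have [/ltW] := bounds k.
  by rewrite nneseriesZl // lte_mul_pinfty // lee_fin powR_ge0.
rewrite lte_add_pinfty ?ltry //; apply: le_lt_trans rho_fin.
by apply: lee_nneseries => // k _; rewrite lee_fin; have [_ /ltW] := bounds k.
Qed.
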